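(* Let $X$ be a metrizable space. Then the following are equivalent: (a) $C_k(X)$ is an Ascoli space; (b) $C_k(X)$ is a $k_{\mathbb{R}}$-space; (c) $X$ is locally compact.
   Context: For a topological space $Z$, $C_k(Z)$ denotes the space of all continuous functions $Z\to\mathbb{R}$ endowed with the compact-open topology. A subset $\mathcal{K}\subset C_k(Z)$ is evenly continuous if the evaluation map $(z,f)\mapsto f(z)$ restricted to $Z\times\mathcal{K}$ is jointly continuous, i.e. for every $z\in Z$, every $f\in\mathcal{K}$ and every neighborhood $O$ of $f(z)$ in $\mathbb{R}$ there are neighborhoods $U_f\subset\mathcal{K}$ of $f$ (in $\mathcal{K}$) and $O_z\subset Z$ of $z$ such that $g(y)\in O$ for all $g\in U_f$, $y\in O_z$. A Tychonoff space $Z$ is called an Ascoli space if every compact subset of $C_k(Z)$ is evenly continuous. A topological space $Z$ is a $k_{\mathbb{R}}$-space if a function $f:Z\to\mathbb{R}$ is continuous if and only if its restriction to each compact subset of $Z$ is continuous. *)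

(* Defs.v *)
From HB Require Import structures.
From mathcomp Require Import all_boot all_order all_algebra.
From mathcomp Require Import all_classical all_reals all_analysis.

Set Implicit Arguments.
Unset Strict Implicit.
Unset Printing Implicit Defensive.

Import Order.TTheory GRing.Theory Num.Theory.
Import numFieldNormedType.Exports.

Local Open Scope classical_set_scope.
Local Open Scope ring_scope.

(* The topology on [Ck R Z] is the one inherited from the compact-open topology
   on all functions Z -> R, whose subbasic open sets are the
   [set g | g @` K `<=` O] with K compact and O open. *)
Definition Ck (R : realType) (Z : topologicalType) : Type :=
  continuousType Z R.

HB.instance Definition _ (R : realType) (Z : topologicalType) :=
  Topological.copy (Ck R Z)
    (initial_topology (id : continuousType Z R -> {compact-open, Z -> R})).

Definition Ck_fun (R : realType) (Z : topologicalType) (f : Ck R Z) : Z -> R :=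
  (f : continuousType Z R).
Coercion Ck_fun : Ck >-> Funclass.

Definition metrizable (R : realType) (X : topologicalType) : Prop :=
  exists d : X -> X -> R,
    [/\ forall x y, d x y = 0 <-> x = y,
        forall x y, d x y = d y x,
        forall x y z, d x z <= d x y + d y z &
        forall (x : X) (A : set X),
          nbhs x A <-> exists2 e : R, 0 < e & [set y | d x y < e] `<=` A].

(* The library's complete regularity separates points from closed sets by
   uniformities; [uniform_separatorP] turns this into separation by continuous
   functions with values in [0, 1]. *)
Definition tychonoff_space (Z : topologicalType) : Prop :=
  completely_regular_space Z /\ hausdorff_space Z.

Definition evenly_continuous (R : realType) (Z : topologicalType)
    (K : set (Ck R Z)) : Prop :=
  {within [set: Z] `*` K, continuous (fun p : Z * Ck R Z => p.2 p.1)}.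

Definition ascoli_space (R : realType) (Z : topologicalType) : Prop :=
  tychonoff_space Z /\
  forall K : set (Ck R Z), compact K -> evenly_continuous K.

Definition kR_space (R : realType) (Z : topologicalType) : Prop :=
  forall f : Z -> R,
    continuous f <->
    forall K : set Z, compact K -> {within K, continuous f}.

(* Main.v *)
Require Import Defs.
From mathcomp Require Import all_boot all_order all_algebra.
From mathcomp Require Import all_classical all_reals all_analysis.
From mathcomp Require Import lra.

(** The implications proved are (b) => (a), (a) => (c) and (c) => (b).

    (b) => (a).  [Ck R X] is Tychonoff ([Ck_tychonoff]), and every Tychonoff
    k_R-space [Z] is Ascoli.  If [K] is a compact subset of [Ck R Z], then
    [y |-> sup_(f in K) |f y - f z|], truncated at 1, is continuous on compact
    sets, hence continuous.  It vanishes at [z], so [K] is equicontinuous at [z]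
    ([kR_equicontinuous]), and even continuity follows ([kR_ascoli]).

    (a) => (c) ([ascoli_locally_compact]).  Suppose that no neighborhood of [x0]
    is compact.  For each [n], the closed ball of radius [1/(n+1)] at [x0]
    contains a sequence [(u n k)_k] without cluster point ([noncompact_seq]),
    and [x0] is the limit of points [q k] different from [x0].  Let [a n k] be a
    nonnegative continuous function that is at least 1 at [u n k], at least
    [2/(n+1)] at [q k], zero at [x0], and at most [2/(n+1)] outside of a ball at
    [u n k], whose radius tends to 0 as [k] grows.  These functions accumulate
    at 0, because a compact set meets only finitely many of the balls for a
    given [n].  On the other hand, compact subsets of [Ck R X] are equicontinuous
    at [x0], since [X] itself is a k_R-space ([metric_kR]); hence each of them
    meets only finitely many of the open sets
    [{g | |g (u n k) - g x0| > 1/2 and |g (q k) - g x0| > 1/(n+1)}].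
    Continuous functions on [Ck R X] that are 1 at [a n k] and 0 outside of
    these sets therefore form, together with 0, a compact set that is not evenly
    continuous ([not_ascoli]).

    (c) => (b) ([locally_compact_kR]).  A locally compact metric space has a
    reflexive symmetric relation [chained] such that the points related to a
    given point form a neighborhood of it ([nbhs_chained]), and those related to
    the points of a compact set lie in a compact set ([compact_chained]).  Sets
    closed under this relation are clopen.  Let [F] be continuous on the compact
    subsets of [Ck R X], but not at [f].  Given [g], the functions that agree
    with [g] on a chain-closed set and with [f] elsewhere form a compact set
    ([compact_splice]), so [F g] is approximated by [F h] where [h] is such a
    function and agrees with [f] outside of the chain-closed hull of a finite
    set ([splice_approx]).  In this way functions [h n] and compact sets [L n]
    are chosen inductively: [h n] is close to [f] on [L n] while [F (h n)] stays
    away from [F f], and [L (n+1)] absorbs the points related to [L n] or to the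
    finite set obtained with [h n].  Then [h n] converges to [f], which
    contradicts the continuity of [F] on the compact set of the [h n] and
    [f]. *)

Set Implicit Arguments.
Unset Strict Implicit.
Unset Printing Implicit Defensive.

Import Order.TTheory GRing.Theory Num.Theory.
Import numFieldNormedType.Exports.

Local Open Scope classical_set_scope.
Local Open Scope ring_scope.

(** * Compactness and continuity of real functions *)

(** A family that converges to [l] along the cofinite filter of its index set
    is compact together with [l]. *)
Lemma compact_cofinite_range (I : Type) (T : topologicalType) (u : I -> T)
    (l : T) :
  (forall V, nbhs l V -> finite_set [set i | ~ V (u i)]) ->
  compact (l |` range u).
Proof.
move=> ful F PF FK; apply: contrapT => noclus.
have [V [W [lV FW VW]]] : exists V W, [/\ nbhs l V, F W & V `&` W = set0].
  apply: contrapT => nVW; apply: noclus; exists l; split; first by left.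
  move=> W V FW lV; apply: contrapT => WV0; apply: nVW.
  by exists V, W; split => //; apply/eqP/negPn/negP => /set0P; rewrite setIC.
have cptf : compact (u @` [set i | ~ V (u i)]).
  by apply/finite_compact/finite_image/ful.
have Ff : F (u @` [set i | ~ V (u i)]).
  apply: filterS (filterI FK FW) => x [Kx Wx].
  have nVx : ~ V x by move=> Vx; rewrite -[False]/(set0 x) -VW.
  case: Kx => [xl|[i _ uix]].
    by case: nVx; rewrite xl; exact: nbhs_singleton.
  by exists i => //=; rewrite uix.
have [y [[i _ <-] cl]] := cptf _ PF Ff.
by apply: noclus; exists (u i); split => //; right; exists i.
Qed.

Lemma real_continuousP (R : realType) (T : topologicalType) (h : T -> R) :
  (continuous h) <->
  (forall (x : T) (e : R), 0 < e -> nbhs x [set y | `|h y - h x| < e]).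
Proof.
split=> [H x e e0|H x].
  move: (H x) => /cvgrPdist_lt /(_ e e0); apply: filterS => y /=.
  by rewrite distrC.
apply/cvgrPdist_lt => e e0; apply: filterS (H x e e0) => y /=.
by rewrite distrC.
Qed.

Lemma real_within_continuousP (R : realType) (T : topologicalType) (K : set T)
    (h : T -> R) :
  {within K, continuous h} <->
  (forall (x : T) (e : R), K x -> 0 < e ->
    nbhs x [set y | K y -> `|h y - h x| < e]).
Proof.
split=> [/subspace_continuousP H x e Kx e0|H].
  move: (H x Kx) => /cvgrPdist_lt /(_ e e0).
  apply: (@filterS _ (nbhs x)) => y /= hy Ky.
  by rewrite distrC; exact: hy.
apply/subspace_continuousP => x Kx; apply/cvgrPdist_lt => e e0.
apply: (@filterS _ (nbhs x) _ _ _ _ (H x e Kx e0)) => y /= hy Ky.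
by rewrite distrC; exact: hy.
Qed.

Section real_functions.
Context {R : realType} {T : topologicalType} (f g : T -> R).
Context (cf : continuous f) (cg : continuous g).

Lemma continuous_maxr : continuous (fun x => Num.max (f x) (g x)).
Proof.
by move=> x; apply: (@continuous_max R T f g x); [exact: cf|exact: cg].
Qed.

Lemma continuous_minr : continuous (fun x => Num.min (f x) (g x)).
Proof.
by move=> x; apply: (@continuous_min R T f g x); [exact: cf|exact: cg].
Qed.

Lemma continuous_addr : continuous (fun x => f x + g x).
Proof.
by move=> x; apply: (@continuousD R R T f g x); [exact: cf|exact: cg].
Qed.

Lemma continuous_subr : continuous (fun x => f x - g x).
Proof.
by move=> x; apply: (@continuousB R R T f g x); [exact: cf|exact: cg].
Qed.

Lemma continuous_mulr : continuous (fun x => f x * g x).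
Proof.
by move=> x; apply: (@continuousM R T f g x); [exact: cf|exact: cg].
Qed.

Lemma continuous_normr : continuous (fun x => `|f x|).
Proof.
by move=> x; apply: continuous_comp; [exact: cf|exact: norm_continuous].
Qed.

End real_functions.

Lemma natinv_lt (R : realType) (e : R) : 0 < e ->
  exists N, forall n, (N <= n)%N -> n.+1%:R^-1 < e.
Proof.
move=> e0; have [N _ NP] := near_infty_natSinv_lt (PosNum e0).
by exists N => n Nn; exact: NP.
Qed.

Lemma natinv_gt0 (R : realType) n : 0 < n.+1%:R^-1 :> R.
Proof. by rewrite invr_gt0 ltr0n. Qed.

(** * The truncated supremum *)

Section capped_sup.
Context {R : realType} {I : Type}.
Implicit Types (P : set I) (u v : I -> R).

(** The supremum over [P] of [u] truncated at 1.  Thanks to the truncation and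
    the added 0, no bound on [u] is needed, and the value for empty [P] is 0. *)
Definition capsup P u : R := sup (0 |` [set Num.min 1 (u i) | i in P]).

Let capsup_has_sup P u : has_sup (0 |` [set Num.min 1 (u i) | i in P]).
Proof.
split; first by exists 0; left.
exists 1 => _ [->|[i _ <-]]; first exact: ler01.
by rewrite ge_min lexx.
Qed.

Lemma capsup_ub P u i : P i -> Num.min 1 (u i) <= capsup P u.
Proof.
by move=> Pi; apply: (ub_le_sup (capsup_has_sup P u).2); right; exists i.
Qed.

Lemma capsup_ge0 P u : 0 <= capsup P u.
Proof. by apply: (ub_le_sup (capsup_has_sup P u).2); left. Qed.

Lemma capsup_le P u c : 0 <= c -> (forall i, P i -> Num.min 1 (u i) <= c) ->
  capsup P u <= c.
Proof.
move=> c0 uc; apply: ge_sup; first by exists 0; left.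
by move=> _ [->|[i Pi <-]] //; exact: uc.
Qed.

Lemma capsup_le1 P u : capsup P u <= 1.
Proof. by apply: capsup_le => // i _; rewrite ge_min lexx. Qed.

Lemma capsup_dist P u v e : 0 <= e -> (forall i, P i -> `|u i - v i| <= e) ->
  `|capsup P u - capsup P v| <= e.
Proof.
move=> e0; have half w t : (forall i, P i -> `|w i - t i| <= e) ->
    capsup P w <= capsup P t + e.
  move=> wt; apply: capsup_le => [|i Pi].
    by rewrite addr_ge0// capsup_ge0.
  have := capsup_ub t Pi; have := wt i Pi; rewrite ler_norml.
  case: (leP 1 (w i)); case: (leP 1 (t i)); lra.
move=> uv; rewrite ler_norml.
have := half u v uv.
have : capsup P v <= capsup P u + e.
  by apply: half => i Pi; rewrite distrC; exact: uv.
lra.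
Qed.

End capped_sup.

(** * The compact-open topology *)

Section Ck_topology.
Context {R : realType} {Z : topologicalType}.
Implicit Types (f g : Ck R Z) (K : set Z) (e : R).

Lemma Ck_continuous f : continuous (f : Z -> R).
Proof. exact: (@cts_fun _ _ (f : continuousType Z R)). Qed.

(** A continuous function, as a point of [Ck R Z]. *)
Definition Ck_of (h : Z -> R) (hc : continuous h) : Ck R Z :=
  Continuous.Pack (Continuous.Class (isContinuous.Build Z R h hc)).

Lemma Ck_eqP f g : (f : Z -> R) =1 g -> f = g.
Proof. by move=> fg; apply/(@continuousEP Z R f g). Qed.

(** The functions that are [e]-close to [f] on [K]; when [K] is compact and
    [0 < e], these sets form a basis of neighborhoods of [f] ([nbhs_CkP]). *)
Definition Ck_ball f K e : set (Ck R Z) :=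
  [set g : Ck R Z | forall x, K x -> `|g x - f x| < e].

Lemma nbhs_Ck_ball f K e : compact K -> 0 < e -> nbhs f (Ck_ball f K e).
Proof.
move=> cK e0.
have cvf : {compact-open,
    (fun g : Ck R Z => (g : Z -> R)) @ nbhs f --> (f : Z -> R)}.
  exact: (@initial_continuous (continuousType Z R)
    {compact-open, Z -> R} id f).
have /(compact_open_fam_compactP (@Ck_continuous f) _) := cvf.
move=> /fam_cvgP /(_ K cK) cvK.
have entE : entourage [set xy : R * R | `|xy.1 - xy.2| < e].
  by rewrite -entourage_ballE; exists e.
have /cvK : nbhs (f : {uniform` K -> R})
    [set g | forall x, K x -> `|f x - g x| < e].
  apply: (iffRL (@uniform_nbhs Z K R f _)).
  exact: (ex_intro _ _ (conj entE (@subset_refl _ _))).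
rewrite /= /nbhs /= => H.
apply: (@filterS _ (nbhs f) _ _ _ _ H) => g /= gK x Kx.
by rewrite distrC; exact: gK.
Qed.

Lemma nbhs_CkP f (A : set (Ck R Z)) :
  nbhs f A <-> exists K e, [/\ compact K, 0 < e & Ck_ball f K e `<=` A].
Proof.
split=> [|[K [e [cK e0 sA]]]]; last first.
  by apply: filterS sA _; exact: nbhs_Ck_ball.
rewrite {1}/nbhs /=.
case=> _ [[B oB <-] /= Bf sBA].
pose I := [set Ke : set Z * R | compact Ke.1 /\ 0 < Ke.2].
(* [G] is the filter generated by the balls; it converges to [f] in the
   compact-open topology. *)
pose G := filter_from I 
  (fun Ke => [set g : Z -> R | forall x, Ke.1 x -> `|g x - f x| < Ke.2]).
have FG : Filter G.
  apply: filter_from_filter.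
    by exists (set0, 1); split => //=; exact: compact0.
  move=> [K1 e1] [K2 e2] [/= cK1 e10] [/= cK2 e20].
  exists (K1 `|` K2, Num.min e1 e2).
    by split => /=; [exact: compactU|rewrite lt_min e10].
  move=> g /= gP; split => x Kx.
    by have := gP x (or_introl Kx); rewrite lt_min => /andP[].
  by have := gP x (or_intror Kx); rewrite lt_min => /andP[].
have /compact_open_cvgP Gf : forall K O, compact K -> open O -> f @` K `<=` O ->
    G [set g | g @` K `<=` O].
  move=> K O cK oO fKO.
  have [] : \forall e \near (0:R)^'+,
      K `<=` [set x | forall y, `|y - f x| < e -> O y].
    have /compact_near_coveringP := cK; apply => x Kx.
    have /nbhs_ballP[e /= e0 eO] : nbhs (f x) O.
      by apply: open_nbhs_nbhs; split => //; apply: fKO; exists x.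
    exists (f @^-1` ball (f x) (e / 2), [set e' | e' < e / 2]) => /=.
      split.
        by apply: Ck_continuous; apply: nbhsx_ballx; rewrite divr_gt0.
      by apply: nbhs_right_lt; rewrite divr_gt0.
    case=> x' e' /= [fx' e'e] y yfx'; apply: eO.
    have := ball_triangle fx' => /(_ y (e / 2)); rewrite -splitr; apply.
    by rewrite /ball /= distrC; apply: lt_trans e'e.
  move=> r /= r0 rP.
  have := rP (r / 2); rewrite /ball_ /= sub0r normrN gtr0_norm ?divr_gt0//.
  rewrite ltr_pdivrMr// mulr_natr mulr2n ltrDl r0 => /(_ isT isT).
  move=> {}rP; exists (K, r / 2); first by split => //=; rewrite divr_gt0.
  by move=> g /= gK _ [x Kx <-]; apply: (rP x Kx); exact: gK.
have /Gf[[K e] [/= cK e0] sB] : nbhs (f : {compact-open, Z -> R}) B.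
  by apply: open_nbhs_nbhs.
by exists K, e; split => // g gb; apply: sBA; exact: sB.
Qed.

Lemma cvg_CkP (F : set_system (Ck R Z)) {FF : Filter F} f :
  F --> f <-> forall K e, compact K -> 0 < e -> F (Ck_ball f K e).
Proof.
split=> [Ff K e cK e0|FP A /nbhs_CkP[K [e [cK e0 sA]]]].
  by apply: Ff; exact: nbhs_Ck_ball.
by apply: filterS sA _; exact: FP.
Qed.

Lemma Ck_eval_continuous (z : Z) : continuous (fun f : Ck R Z => f z).
Proof.
apply/real_continuousP => f e e0.
apply/nbhs_CkP; exists [set z], e; split=> //; first exact: compact_set1.
by move=> g /(_ z erefl).
Qed.

Lemma Ck_hausdorff : hausdorff_space (Ck R Z).
Proof.
move=> f g fg; apply: Ck_eqP => x; apply/eqP; rewrite -subr_eq0 -normr_eq0.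
rewrite eq_le normr_ge0 andbT; apply/ler_addgt0Pl => e e0; rewrite addr0.
have e20 : 0 < e / 2 by rewrite divr_gt0.
have [h [/(_ x erefl) hf /(_ x erefl) hg]] := fg _ _
  (nbhs_Ck_ball f (@compact_set1 _ x) e20)
  (nbhs_Ck_ball g (@compact_set1 _ x) e20).
rewrite (splitr e); apply: le_trans (ler_distD (h x) _ _) _.
by apply: lerD; [rewrite distrC|]; exact: ltW.
Qed.

End Ck_topology.
Lemma Ck_tychonoff (R : realType) (Z : topologicalType) :
  tychonoff_space (Ck R Z).
Proof.
split; last exact: Ck_hausdorff.
move=> a B clB nBa; apply/(@uniform_separatorP _ R).
have /nbhs_CkP[K [e [cK e0 sB]]] : nbhs a (~` B).
  by apply: open_nbhs_nbhs; split => //; exact: closed_openC.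
pose h (g : Ck R Z) := capsup K (fun x => `|g x - a x| / e).
exists h; split.
- apply/real_continuousP => g eps eps0; apply/nbhs_CkP.
  exists K, (eps / 2 * e); split => //; first by rewrite !mulr_gt0 ?invr_gt0.
  move=> g' gg'; rewrite /=.
  apply: (@le_lt_trans _ _ (eps / 2)); last lra.
  apply: capsup_dist => [|x Kx]; first lra.
  rewrite -mulrBl normrM [X in _ * X]gtr0_norm ?invr_gt0// ler_pdivrMr//.
  apply/(le_trans (ler_dist_dist _ _)); rewrite [X in `|X|](_ : _ = g' x - g x).
    exact/ltW/gg'.
  by rewrite opprB addrA subrK.
- move=> _ [g _ <-] /=; rewrite in_itv /=.
  by rewrite capsup_ge0 capsup_le1.
- move=> _ [_ -> <-] /=; apply/eqP; rewrite eq_le capsup_ge0 andbT.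
  apply: capsup_le => // x Kx; rewrite subrr normr0 mul0r.
  by rewrite ge_min lexx orbT.
- move=> _ [b Bb <-] /=; apply/eqP; rewrite eq_le capsup_le1 /=.
  have : ~ Ck_ball a K e b by move=> /sB.
  move=> /existsNP[x /not_implyP[Kx /negP]]; rewrite -leNgt => ex.
  apply: le_trans (capsup_ub _ Kx); rewrite le_min lexx /=.
  by rewrite ler_pdivlMr// mul1r.
Qed.

(** * k_R-spaces are Ascoli spaces *)

Lemma kR_equicontinuous (R : realType) (Z : topologicalType)
    (K : set (Ck R Z)) (z : Z) (e : R) :
  kR_space R Z -> compact K -> 0 < e ->
  nbhs z [set y | forall f, K f -> `|f y - f z| < e].
Proof.
move=> kRZ cK e0.
pose p (y : Z) := capsup K (fun f : Ck R Z => `|f y - f z|).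
have cp : continuous p.
  apply/kRZ => L cL; apply/real_within_continuousP => y eps Ly eps0.
  (* [K] is compact and evaluation is jointly continuous on [L * K]. *)
  have : \forall y' \near within L (nbhs y),
      K `<=` [set f : Ck R Z | `|f y' - f y| < eps / 2].
    have /compact_near_coveringP := cK; apply => f Kf.
    exists (Ck_ball f L (eps / 6), [set y' | L y' /\ `|f y' - f y| < eps / 6]).
      split; first by apply: nbhs_Ck_ball => //; lra.
      have /real_continuousP/(_ y (eps / 6)) := @Ck_continuous _ _ f.
      have eps6 : 0 < eps / 6 by lra.
      move=> /(_ eps6); apply: (@filterS _ (nbhs y)) => y' /= fy' Ly'; by split.
    case=> g y' /= [fg [Ly' fy']].
    have := fg _ Ly'; have := fg _ Ly.
    have := ler_distD (f y') (g y') (g y); have := ler_distD (f y) (f y') (g y).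
    rewrite (distrC (f y) (g y)); lra.
  apply: (@filterS _ (nbhs y)) => y' /= H Ly'.
  apply: (@le_lt_trans _ _ (eps / 2)); last lra.
  apply: capsup_dist => [|f Kf]; first lra.
  apply/(le_trans (ler_dist_dist _ _)).
  rewrite [X in `|X|](_ : _ = f y' - f y); last by rewrite opprB addrA subrK.
  exact/ltW/H.
have pz : p z = 0.
  apply/eqP; rewrite eq_le capsup_ge0 andbT.
  by apply: capsup_le => // f _; rewrite subrr normr0 ge_min lexx orbT.
have e1 : 0 < Num.min 1 e by rewrite lt_min e0 ltr01.
have /real_continuousP/(_ z _ e1) := cp.
apply: (@filterS _ (nbhs z)) => y /= py f Kf.
have : Num.min 1 `|f y - f z| <= p y.
  exact: (capsup_ub (fun f : Ck R Z => `|f y - f z|) Kf).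
move: py; rewrite pz subr0 ger0_norm ?capsup_ge0//.
by rewrite lt_min => /andP[p1 pe]; case: (leP 1 `|f y - f z|); lra.
Qed.

Lemma kR_ascoli (R : realType) (Z : topologicalType) :
  tychonoff_space Z -> kR_space R Z -> ascoli_space R Z.
Proof.
move=> TZ kRZ; split => // K cK; apply/real_within_continuousP.
move=> [z f] e [_ /= Kf] e0.
have e20 : 0 < e / 2 by lra.
exists ([set y | forall g, K g -> `|g y - g z| < e / 2],
        Ck_ball f [set z] (e / 2)).
  split; first exact: kR_equicontinuous.
  by apply: nbhs_Ck_ball => //; exact: compact_set1.
case=> y g /= [gyz /(_ z erefl) gf] [_ Kg].
have := gyz g Kg; have := ler_distD (g z) (g y) (f z); lra.
Qed.

(** * A criterion for failure of the Ascoli property *)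

(** A space is not Ascoli if it has a family [f i] of functions, finitely many
    of which are nonzero on a given compact set, and points [a i] that cluster
    at [z] along the cofinite filter and satisfy [f i (a i) = 1]: the family and
    0 form a compact set, whose evaluation map is not continuous at [(z, 0)]. *)
Lemma not_ascoli (R : realType) (Z : topologicalType) (I : Type)
    (f : I -> Ck R Z) (a : I -> Z) (z : Z) :
  (forall C, compact C -> finite_set [set i | exists2 x, C x & f i x <> 0]) ->
  (forall i, f i (a i) = 1) ->
  (forall O (J : set I), nbhs z O -> finite_set J ->
    exists2 i, ~ J i & O (a i)) ->
  ~ ascoli_space R Z.
Proof.
move=> finf fa1 az [_ ascZ].
pose f0 : Ck R Z := Ck_of (@cst_continuous Z R 0).
have cK : compact (f0 |` range f).
  apply: compact_cofinite_range => V /nbhs_CkP[C [e [cC e0 eV]]].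
  apply: sub_finite_set (finf C cC) => i /= nV; apply: contrapT => nx.
  apply: nV; apply: eV => x Cx; change (`|f i x - 0| < e); rewrite subr0.
  suff -> : f i x = 0 by rewrite normr0.
  by apply: contrapT => fix0; apply: nx; exists x.
have /real_within_continuousP/(_ (z, f0) 1) := ascZ _ cK.
move=> /(_ (conj Logic.I (or_introl erefl)) ltr01)[[W V] /= [zW f0V] WV].
have /nbhs_CkP[C [e [cC e0 eV]]] := f0V.
have [i nfi Oai] := az W _ zW (finf C cC).
have : `|f i (a i) - 0| < 1.
  apply: (WV (a i, f i)); last by split => //; right; exists i.
  split => //; apply: eV => x Cx; change (`|f i x - 0| < e); rewrite subr0.
  suff -> : f i x = 0 by rewrite normr0.
  by apply: contrapT => fix0; apply: nfi; exists x.
by rewrite fa1 subr0 normr1 ltxx.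
Qed.

(** * Metrizable spaces *)

Section metric.
Context {R : realType} {X : topologicalType} (d : X -> X -> R).
Context (d_eq0 : forall x y, d x y = 0 <-> x = y).
Context (dC : forall x y, d x y = d y x).
Context (dD : forall x y z, d x z <= d x y + d y z).
Context (nbhs_d : forall (x : X) (A : set X),
  nbhs x A <-> exists2 e : R, 0 < e & [set y | d x y < e] `<=` A).

Lemma dxx x : d x x = 0. Proof. exact/d_eq0. Qed.

Lemma d_ge0 x y : 0 <= d x y.
Proof. by have := dD x y x; rewrite dxx (dC y x); lra. Qed.

Lemma d_gt0 x y : x <> y -> 0 < d x y.
Proof.
by move=> xy; rewrite lt_neqAle d_ge0 andbT; apply/eqP => /esym/d_eq0.
Qed.

Lemma nbhs_dball x e : 0 < e -> nbhs x [set y | d x y < e].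
Proof. by move=> e0; apply/nbhs_d; exists e. Qed.

Lemma metric_hausdorff : hausdorff_space X.
Proof.
move=> x y xy; apply: contrapT => /d_gt0 dxy.
have e0 : 0 < d x y / 2 by lra.
have [z [/= dxz dyz]] := xy _ _ (nbhs_dball x e0) (nbhs_dball y e0).
by have := dD x z y; rewrite (dC z y); lra.
Qed.

Lemma d_continuous x : continuous (d x).
Proof.
apply/real_continuousP => y e e0; apply/nbhs_d; exists e => // z /= yz.
have := dD x y z; have := dD x z y; rewrite (dC z y) => *.
by rewrite ltr_norml; lra.
Qed.

(** A discontinuity of [f] at [x] is witnessed by a sequence converging to [x],
    which forms a compact set with [x]. *)
Lemma metric_kR : kR_space R X.
Proof.
move=> f; split=> [cf K _|kf]; first exact: continuous_subspaceT.
apply/real_continuousP => x e e0; apply: contrapT => nx.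
have /choice[y yP] : forall n, exists y,
    d x y < n.+1%:R^-1 /\ ~ `|f y - f x| < e.
  move=> n; apply: contrapT => ny; apply: nx; apply/nbhs_d.
  exists n.+1%:R^-1; first exact: natinv_gt0.
  by move=> y /= xy; apply: contrapT => fyx; apply: ny; exists y.
have cK : compact (x |` range y).
  apply: compact_cofinite_range => V /nbhs_d[r r0 rV].
  have [N NP] := natinv_lt r0.
  apply: (sub_finite_set _ (finite_II N)) => n /= nV.
  rewrite ltnNge; apply/negP => /NP nr; apply: nV; apply: rV.
  exact: lt_trans (yP n).1 nr.
have /real_within_continuousP/(_ x e (or_introl erefl) e0) := kf _ cK.
move=> /nbhs_d[r r0 rP]; have [N /(_ N (leqnn N)) Nr] := natinv_lt r0.
apply: (yP N).2; apply: rP => /=; first exact: lt_trans (yP N).1 Nr.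
by right; exists N.
Qed.

(** If every sequence of [A] had a cluster point, every ultrafilter on [A] would
    contain balls of every radius, and would converge to a cluster point of a
    sequence chosen in smaller and smaller such balls. *)
Lemma noncompact_seq (A : set X) : closed A -> ~ compact A ->
  exists u : nat -> X, (forall k, A (u k)) /\
    forall x, exists e N, 0 < e /\ forall k, (N <= k)%N -> e <= d x (u k).
Proof.
move=> clA ncA; apply: contrapT => nu; apply: ncA.
have clus (u : nat -> X) : (forall k, A (u k)) -> exists x, forall e N, 0 < e ->
    exists2 k, (N <= k)%N & d x (u k) < e.
  move=> uA; apply: contrapT => nx; apply: nu; exists u; split => // x.
  apply: contrapT => neN; apply: nx; exists x => e N e0; apply: contrapT => nk.
  apply: neN; exists e, N; split => // k Nk; rewrite leNgt; apply/negP => xk.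
  by apply: nk; exists k.
rewrite compact_ultra => F UF FA.
have tb e : 0 < e -> exists c, F [set y | d c y < e].
  move=> e0; apply: contrapT => nc.
  (* Otherwise [F] avoids every [e]-ball, hence finite unions of [e]-balls, and
     an [e]-separated sequence of points of [A] can be chosen. *)
  have ncF c : F (~` [set y | d c y < e]).
    have [Fc|//] := in_ultra_setVsetC [set y | d c y < e] UF.
    by case: nc; exists c.
  have /choice[f fP] : forall s : seq X, exists y,
      A y /\ forall c, c \in s -> e <= d c y.
    move=> s; have : F (A `&` [set y | forall c, c \in s -> e <= d c y]).
      elim: s => [|c s IHs]; first by apply: filterS FA.
      apply: filterS (filterI IHs (ncF c)) => y [[Ay ys] /negP cy].
      split => // c'.
      rewrite in_cons => /orP[/eqP ->|]; last exact: ys.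
      by rewrite leNgt.
    by move=> /filter_ex[y [Ay ys]]; exists y.
  pose us n := iter n (fun s => f s :: s) [::].
  pose u n := f (us n).
  have uus m n : (m < n)%N -> u m \in us n.
    elim: n => // n IHn; rewrite ltnS leq_eqVlt => /orP[/eqP ->|/IHn].
      by rewrite /= in_cons eqxx.
    by rewrite /= in_cons orbC => ->.
  have [x xP] := clus u (fun k => (fP (us k)).1).
  have e20 : 0 < e / 2 by lra.
  have [k _ xk] := xP _ 0%N e20; have [k' kk' xk'] := xP _ k.+1 e20.
  have := (fP (us k')).2 _ (uus _ _ kk'); rewrite -/(u k').
  by have := dD (u k) x (u k'); rewrite (dC (u k) x); lra.
have /choice[c cP] : forall n, exists c, F [set y | d c y < n.+1%:R^-1].
  by move=> n; apply/tb/natinv_gt0.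
have /choice[y yP] : forall n, exists y,
    A y /\ forall m, (m <= n)%N -> d (c m) y < m.+1%:R^-1.
  move=> n; have : F (A `&`
      [set y | forall m, (m < n.+1)%N -> d (c m) y < m.+1%:R^-1]).
    elim: n.+1 => [|k IHk]; first by apply: filterS FA.
    apply: filterS (filterI IHk (cP k)) => y [[Ay yk] cy]; split => // m.
    by rewrite ltnS leq_eqVlt => /orP[/eqP ->//|]; exact: yk.
  by move=> /filter_ex[y [Ay ys]]; exists y.
have [p pP] := clus y (fun k => (yP k).1).
exists p; split.
  apply: clA => V /nbhs_d[e e0 eV]; have [k _ pk] := pP e 0%N e0.
  by exists (y k); split; [exact: (yP k).1|exact: eV].
move=> V /nbhs_d[e e0 eV]; have e30 : 0 < e / 3 by lra.
have [N /(_ N (leqnn N)) Ne] := natinv_lt e30.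
have [k Nk pk] := pP _ N e30; have cyk := (yP k).2 _ Nk.
have {}cyk := lt_trans cyk Ne.
apply: filterS (cP N) => z /= /lt_trans/(_ Ne) cz; apply: eV => /=.
have := dD p (y k) z; have := dD (y k) (c N) z; rewrite (dC (y k) (c N)); lra.
Qed.

(** * Local compactness from the Ascoli property *)

Lemma ascoli_locally_compact :
  ascoli_space R (Ck R X) -> locally_compact [set: X].
Proof.
move=> ascX x0 _; apply: contrapT => nlc.
have ncpt (U : set X) : nbhs x0 U -> ~ compact U.
  move=> x0U cU; apply: nlc; exists U; last first.
    by split => //; exact: compact_closed metric_hausdorff cU.
  by apply: (@filterS _ (nbhs x0) _ _ _ _ x0U).
have /choice[u uP] : forall n, exists u : nat -> X,
    [/\ forall k, d x0 (u k) <= n.+1%:R^-1, forall k, 0 < d x0 (u k) &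
    forall x, exists e N, 0 < e /\ forall k, (N <= k)%N -> e <= d x (u k)].
  move=> n.
  have [||u [un uP]] := @noncompact_seq [set y | d x0 y <= n.+1%:R^-1].
  - apply: (@preimage_closed _ _ (d x0) [set r | r <= n.+1%:R^-1]).
      by move=> x _; exact: d_continuous.
    exact: closed_le.
  - apply: ncpt; apply/nbhs_d; exists n.+1%:R^-1; first exact: natinv_gt0.
    by move=> y /= /ltW.
  - have [e [N [e0 NP]]] := uP x0.
    (* Dropping finitely many terms keeps the sequence away from [x0]. *)
    exists (fun k => u (k + N)%N); split => [k|k|x]; first exact: un.
      by apply: lt_le_trans (NP _ (leq_addl _ _)).
    have [e' [N' [e'0 N'P]]] := uP x; exists e', N'; split => // k Nk.
    by apply: N'P; exact: leq_trans Nk (leq_addr _ _).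
have /choice[q qP] : forall k, exists y, 0 < d x0 y /\ d x0 y < k.+1%:R^-1.
  move=> k; apply: contrapT => ny.
  apply: (ncpt [set x0]); last exact: compact_set1.
  apply/nbhs_d; exists k.+1%:R^-1; first exact: natinv_gt0.
  move=> y /= x0y; apply: contrapT => yx0; apply: ny; exists y; split => //.
  by apply: d_gt0 => x0E; apply: yx0; rewrite x0E.
(* [bump (n, k)] is supported in the ball of radius [rho n k] at [u n k]; this
   ball excludes [x0], and its radius tends to 0 as [k] grows. *)
pose rho n k := Num.min k.+1%:R^-1 (d x0 (u n k)).
have rho0 n k : 0 < rho n k.
  by have [_ un _] := uP n; rewrite lt_min natinv_gt0 un.
pose base (i : nat * nat) x :=
  2 * i.1.+1%:R^-1 * Num.min 1 (d x0 x / d x0 (q i.2)).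
pose bump (i : nat * nat) x := Num.max 0 (1 - d (u i.1 i.2) x / rho i.1 i.2).
have base_ge0 i x : 0 <= base i x.
  rewrite !mulr_ge0 ?ler0n ?invr_ge0//.
  by rewrite le_min ler01 divr_ge0// d_ge0.
have base_le i x : base i x <= 2 * i.1.+1%:R^-1.
  by rewrite ler_piMr ?mulr_ge0 ?invr_ge0// ge_min lexx.
have bump_ge0 i x : 0 <= bump i x by rewrite le_max lexx.
have ca i : continuous (fun x => base i x + bump i x).
  apply: continuous_addr.
    apply: continuous_mulr; first exact: cst_continuous.
    apply: continuous_minr; first exact: cst_continuous.
    apply: continuous_mulr; first exact: d_continuous.
    exact: cst_continuous.
  apply: continuous_maxr; first exact: cst_continuous.
  apply: continuous_subr; first exact: cst_continuous.
  apply: continuous_mulr; first exact: d_continuous.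
  exact: cst_continuous.
pose a i := Ck_of (ca i).
have ax0 i : a i x0 = 0.
  change (base i x0 + bump i x0 = 0).
  rewrite /base /bump dxx mul0r min_r// mulr0 add0r max_l// subr_le0.
  by rewrite ler_pdivlMr// mul1r dC ge_min lexx orbT.
have au i : 1 <= a i (u i.1 i.2).
  change (1 <= base i (u i.1 i.2) + bump i (u i.1 i.2)).
  rewrite -[leLHS]add0r lerD// /bump dxx mul0r subr0.
  by rewrite le_max lexx orbT.
have aq i : 2 * i.1.+1%:R^-1 <= a i (q i.2).
  change (2 * i.1.+1%:R^-1 <= base i (q i.2) + bump i (q i.2)).
  rewrite -[leLHS]addr0 lerD// /base divff ?gt_eqF ?min_l ?mulr1//.
  by case: (qP i.2).
(* [s (n, k)] and [t (n, k)] are nonzero exactly where the differences between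
   [g x0] and the values of [g] at [u n k] and [q k] exceed 1/2 and 1/(n+1),
   respectively. *)
pose s (i : nat * nat) (g : Ck R X) :=
  Num.max 0 (`|g (u i.1 i.2) - g x0| - 2^-1).
pose t (i : nat * nat) (g : Ck R X) :=
  Num.max 0 (`|g (q i.2) - g x0| - i.1.+1%:R^-1).
have sa i : 0 < s i (a i).
  by rewrite lt_max ltxx orFb ax0 subr0 subr_gt0 ger0_norm; have := au i; lra.
have ta i : 0 < t i (a i).
  rewrite lt_max ltxx orFb ax0 subr0 subr_gt0.
  apply: lt_le_trans (ler_norm _); apply: lt_le_trans (aq i).
  by rewrite mulr_natl mulr2n ltrDl natinv_gt0.
have cf i : continuous (fun g => (s i (a i) * t i (a i))^-1 * (s i g * t i g)).
  apply: continuous_mulr; first exact: cst_continuous.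
  apply: continuous_mulr;
    (apply: continuous_maxr; first exact: cst_continuous);
    (apply: continuous_subr; last exact: cst_continuous);
    apply: continuous_normr;
    by apply: continuous_subr; exact: Ck_eval_continuous.
pose f i := Ck_of (cf i).
pose z0 : Ck R X := Ck_of (@cst_continuous X R 0).
apply: (@not_ascoli R (Ck R X) _ f a z0) ascX => [C cC|i|W J].
(* On a compact [C], equicontinuity at [x0] makes [s (n, k)] vanish for large
   [n], and [t (n, k)] vanish for large [k], uniformly in the remaining [n]. *)
- have h0 : 0 < 2^-1 :> R by rewrite invr_gt0.
  have /nbhs_d[r r0 rP] := kR_equicontinuous x0 metric_kR cC h0.
  have [N NP] := natinv_lt r0.
  have /nbhs_d[r' r'0 r'P] :=
    kR_equicontinuous x0 metric_kR cC (natinv_gt0 R N).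
  have [N' N'P] := natinv_lt r'0.
  apply: (sub_finite_set _ (finite_setX (finite_II N) (finite_II N'))).
  move=> i /= [g Cg fig].
  have iN : (i.1 < N)%N.
    rewrite ltnNge; apply/negP => Ni; apply: fig.
    change ((s i (a i) * t i (a i))^-1 * (s i g * t i g) = 0).
    suff -> : s i g = 0 by rewrite mul0r mulr0.
    apply: max_l; rewrite subr_le0; apply/ltW/rP => //=.
    have [ux0 _ _] := uP i.1.
    exact: le_lt_trans (ux0 _) (NP _ Ni).
  split => //; rewrite ltnNge; apply/negP => Ni; apply: fig.
  change ((s i (a i) * t i (a i))^-1 * (s i g * t i g) = 0).
  suff -> : t i g = 0 by rewrite !mulr0.
  apply: max_l; rewrite subr_le0; apply: (@le_trans _ _ N.+1%:R^-1).
    by apply/ltW/r'P => //=; exact: lt_trans (qP _).2 (N'P _ Ni).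
  by rewrite lef_pV2 ?posrE// ler_nat ltnS ltnW.
- change ((s i (a i) * t i (a i))^-1 * (s i (a i) * t i (a i)) = 1).
  by rewrite mulVf// mulf_neq0// gt_eqF.
(* First [n] is chosen so that [base] is small, then [k] so that [bump] vanishes
   on [K] and [(n, k)] is not in [J]. *)
move=> /nbhs_CkP[K [e [cK e0 eW]]] fJ.
have e20 : 0 < e / 2 by lra.
have [n /(_ n (leqnn n)) ne] := natinv_lt e20.
have [N _ NP] : \forall k \near \oo, K `<=` [set x | k.+1%:R^-1 <= d (u n k) x].
  have /compact_near_coveringP := cK; apply => x Kx.
  have [_ _ /(_ x)[r [N [r0 NP]]]] := uP n.
  have r20 : 0 < r / 2 by lra.
  have [N' N'P] := natinv_lt r20.
  exists ([set y | d x y < r / 2], [set k | (maxn N N' <= k)%N]).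
    by split; [exact: nbhs_dball|exists (maxn N N')].
  case=> y k /= [xy]; rewrite geq_max => /andP[/NP Nk /N'P N'k].
  apply: ltW; apply: lt_le_trans N'k _.
  by have := dD x y (u n k); rewrite (dC (u n k)); lra.
have [k Nk nJk] : exists2 k, (N <= k)%N & ~ J (n, k).
  apply: contrapT => nk; apply: infinite_nat.
  apply: (sub_finite_set _ (_ : finite_set (`I_N `|` snd @` J))).
    move=> k _; case: (ltnP k N) => Nk; [by left|right].
    by exists (n, k) => //; apply: contrapT => nJ; apply: nk; exists k.
  by rewrite finite_setU; split; [exact: finite_II|exact: finite_image].
exists (n, k) => //; apply: eW => x Kx.
change (`|base (n, k) x + bump (n, k) x - 0| < e).
have -> : bump (n, k) x = 0.
  apply: max_l; rewrite subr_le0 ler_pdivlMr// mul1r.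
  by apply: le_trans (NP k Nk x Kx); rewrite ge_min lexx.
rewrite addr0 subr0 ger0_norm//; apply: le_lt_trans (base_le _ _) _ => /=.
by move: ne; rewrite ltr_pdivlMr// mulrC.
Qed.

(** * The k_R-property from local compactness *)

(** The ball of radius [r] at [x] is contained in a compact set. *)
Definition ball_in_compact x r :=
  exists2 K, compact K & [set y | d x y < r] `<=` K.

Lemma ball_in_compact_sub x y r r' : d x y + r' <= r ->
  ball_in_compact x r -> ball_in_compact y r'.
Proof.
move=> rr' [K cK xK]; exists K => // z /= yz; apply: xK => /=.
by have := dD x y z; lra.
Qed.

(** Closeness of two points relative to the radii of their relatively compact
    balls.  The factor 4 leaves room for the triangle inequality in
    [compact_chained], and the discrete sequence of radii [1/(n+1)] makes it
    possible to choose a largest radius there. *)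
Definition chained x y := exists n,
  [/\ d x y < n.+1%:R^-1, ball_in_compact x (4 * n.+1%:R^-1) &
      ball_in_compact y (4 * n.+1%:R^-1)].

Lemma chained_sym x y : chained x y -> chained y x.
Proof. by move=> [n [xy Px Py]]; exists n; rewrite dC. Qed.

(** The unions of classes of the equivalence relation generated by [chained];
    they are clopen when [X] is locally compact. *)
Definition chain_closed (A : set X) :=
  forall x y, A x -> chained x y -> A y.

Context (lcX : locally_compact [set: X]).

Lemma small_ball_in_compact x : exists2 r, 0 < r & ball_in_compact x r.
Proof.
have [U + [cU _]] := lcX (Logic.I : [set: X] x).
rewrite /within /= => /nbhs_d[r r0 rU].
by exists r => //; exists U => // y /rU; apply.
Qed.

Lemma nbhs_chained x : nbhs x [set y | chained x y].
Proof.
have [r r0 Pr] := small_ball_in_compact x.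
have r50 : 0 < r / 5 by lra.
have [N /(_ N (leqnn N)) Ne] := natinv_lt r50.
apply/nbhs_d; exists N.+1%:R^-1; first exact: natinv_gt0.
move=> y /= xy; exists N; set e := N.+1%:R^-1 in Ne xy *.
by split => //; apply: ball_in_compact_sub Pr; rewrite ?dxx; lra.
Qed.

Lemma chained_refl x : chained x x.
Proof. exact: nbhs_singleton (nbhs_chained x). Qed.

(** If [N] is least such that the ball of radius [3/(N+1)] at [x] is relatively
    compact, that ball contains all chain-neighbors of the points that are
    [1/(N+1)]-close to [x]. *)
Lemma compact_chained (K : set X) : compact K ->
  exists2 D, compact D & forall x y, K x -> chained x y -> D y.
Proof.
move=> cK.
(* [G] is the filter of large compact sets. *)
pose G : set_system (set X) := filter_from [set C | compact C]
  (fun C => [set D | compact D /\ C `<=` D]).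
have FG : Filter G.
  apply: filter_from_filter; first by exists set0; exact: compact0.
  move=> C D cC cD; exists (C `|` D); first exact: compactU.
  by move=> S [cS CDS]; split; split => // x Cx; apply: CDS; [left|right].
have [C cC CP] : \forall D \near G,
    K `<=` [set x | forall y, chained x y -> D y].
  have /compact_near_coveringP := cK; apply => x Kx.
  have exN : exists N, `[< ball_in_compact x (3 * N.+1%:R^-1) >].
    have [r r0 Pr] := small_ball_in_compact x.
    have r30 : 0 < r / 3 by lra.
    have [N /(_ N (leqnn N)) Ne] := natinv_lt r30.
    exists N; apply/asboolP; set e := N.+1%:R^-1 in Ne *.
    by apply: ball_in_compact_sub Pr; rewrite dxx; lra.
  case: (ex_minnP exN) => N /asboolP [C cC CP] Nmin.
  exists ([set y | d x y < N.+1%:R^-1], [set D | compact D /\ C `<=` D]).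
    by split; [exact: nbhs_dball (natinv_gt0 R N)|exists C].
  case=> x' D /= [xx' [_ CD]] y [n [x'y Px' _]]; apply/CD/CP => /=.
  have [Nn|nN] := leqP N n.
    have : n.+1%:R^-1 <= N.+1%:R^-1 :> R by rewrite lef_pV2 ?posrE// ler_nat.
    move: x'y xx' (dD x x' y) (natinv_gt0 R N).
    by set en := n.+1%:R^-1; set eN := N.+1%:R^-1; lra.
  have : n.+1%:R^-1 >= N.+1%:R^-1 :> R by rewrite lef_pV2 ?posrE// ler_nat ltnW.
  move=> nN'; have : (N <= n)%N.
    apply: Nmin; apply/asboolP; apply: ball_in_compact_sub Px'.
    by rewrite (dC x' x); set en := n.+1%:R^-1 in x'y nN' *;
      set eN := N.+1%:R^-1 in nN' xx'; lra.
  by rewrite leqNgt nN.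
exists C => // x y Kx xy.
by apply: (CP C _ x Kx y xy); split.
Qed.

Section splice.
Context (f g : Ck R X).

Lemma splice_continuous (A : set X) : chain_closed A ->
  continuous (fun x => if `[< A x >] then g x else f x).
Proof.
move=> Acl; apply/real_continuousP => x e e0.
have /real_continuousP/(_ x e e0) := @Ck_continuous _ _ f.
have /real_continuousP/(_ x e e0) := @Ck_continuous _ _ g.
move=> gx fx; apply: filterS (filterI (nbhs_chained x) (filterI fx gx)).
move=> y /= [xy [fy gy]].
have -> : `[< A y >] = `[< A x >].
  apply/asboolP/asboolP => [Ay|Ax]; last exact: Acl xy.
  exact: Acl (chained_sym xy).
by case: ifP.
Qed.

(** The functions obtained from [f] by replacing it with [g] on a chain-closed
    set. *)
Definition splice_set : set (Ck R X) :=
  [set h | exists2 A, chain_closed A &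
    forall x, h x = if `[< A x >] then g x else f x].

(** The set of chain-closed sets is closed in the compact space of all subsets
    of [X], and splicing depends continuously on the chain-closed set.
    Concretely, an ultrafilter [F] on [splice_set] converges to the splice along
    the set of the points [x] such that [F]-almost every function is a splice
    along a set containing [x]. *)
Lemma compact_splice : compact splice_set.
Proof.
rewrite compact_ultra => F UF FC.
pose S x := [set h : Ck R X | exists A, [/\ chain_closed A,
    forall x, h x = if `[< A x >] then g x else f x & A x]].
pose A := [set x | F (S x)].
have clA : chain_closed A.
  move=> x y Ax xy; apply: filterS Ax => h [B [clB hB Bx]].
  by exists B; split => //; exact: clB xy.
exists (Ck_of (splice_continuous clA)); split; first by exists A.
apply/cvg_CkP => K e cK e0.
have : F [set h : Ck R X | K `<=`
    [set x | h x = if `[< A x >] then g x else f x]].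
  have /compact_near_coveringP := cK.
  move=> /(_ (Ck R X) F (fun h x => h x = if `[< A x >] then g x else f x)).
  apply => x Kx.
  have [Ax|nAx] := pselect (A x).
    exists ([set y | chained x y], S x).
      by split => //; exact: nbhs_chained.
    case=> y h /= [xy [B [clB hB Bx]]]; rewrite hB.
    have -> : `[< B y >] by apply/asboolP; exact: clB xy.
    by have -> : `[< A y >] by apply/asboolP; exact: clA xy.
  exists ([set y | chained x y], splice_set `&` ~` S x).
    split; first exact: nbhs_chained.
    by apply: filterI => //; have [/nAx|] := in_ultra_setVsetC (S x) UF.
  case=> y h /= [xy [[B clB hB] nSh]]; rewrite hB.
  have -> : `[< B y >] = false.
    apply/asboolP => By; apply: nSh; exists B; split => //.
    exact: clB (chained_sym xy).
  suff -> : `[< A y >] = false by [].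
  by apply/asboolP => Ay; apply: nAx; exact: clA (chained_sym xy).
apply: filterS => h hA x Kx.
change (`|h x - (if `[< A x >] then g x else f x)| < e).
by rewrite -(hA x Kx) subrr normr0.
Qed.

(** The splices along the chain-closed hulls of finite sets [T] converge to [g]
    as [T] grows, because a compact set is contained in one of these hulls. *)
Lemma splice_approx (F : Ck R X -> R) (e : R) :
  (forall K : set (Ck R X), compact K -> {within K, continuous F}) -> 0 < e ->
  exists (T : seq X) (h : Ck R X), [/\ `|F h - F g| < e,
    forall x, h x = g x \/ h x = f x &
    forall B, chain_closed B -> (forall t, t \in T -> B t) ->
      forall x, ~ B x -> h x = f x].
Proof.
move=> kF e0.
have gC : splice_set g.
  by exists setT => // x; have -> : `[< [set: X] x >] by apply/asboolP.
have /real_within_continuousP/(_ g e gC e0) := kF _ compact_splice.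
move=> /nbhs_CkP[K [r [cK r0 rP]]].
pose hull (T : seq X) := [set x | forall B, chain_closed B ->
  (forall t, t \in T -> B t) -> B x].
have hull_cl T : chain_closed (hull T).
  by move=> x y Tx xy B clB TB; apply: (clB x y) => //; exact: Tx.
pose G : set_system (seq X) := filter_from [set: seq X]
  (fun T : seq X => [set T' : seq X | {subset T <= T'}]).
have FG : Filter G.
  apply: filter_from_filter; first by exists [::].
  move=> S T _ _; exists (S ++ T) => // T' sT'.
  by split=> x xS; apply: sT'; rewrite mem_cat xS// orbT.
have [T _ /(_ T) TP] : \forall T \near G, K `<=` hull T.
  have /compact_near_coveringP := cK; apply => x Kx.
  exists ([set y | chained x y], [set T : seq X | {subset [:: x] <= T}]).
    by split; [exact: nbhs_chained|exists [:: x]].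
  case=> y T /= [xy xT] B clB TB; apply: clB xy; apply/TB/xT.
  by rewrite mem_seq1.
exists T, (Ck_of (splice_continuous (@hull_cl T))); split.
- apply: rP; last by exists (hull T).
  move=> x Kx; change (`|(if `[< hull T x >] then g x else f x) - g x| < r).
  have -> : `[< hull T x >] by apply/asboolP; exact: TP.
  by rewrite subrr normr0.
- move=> x; change ((if `[< hull T x >] then g x else f x) = g x \/
    (if `[< hull T x >] then g x else f x) = f x).
  by case: ifP; [left|right].
- move=> B clB TB x nBx; change ((if `[< hull T x >] then g x else f x) = f x).
  have -> // : `[< hull T x >] = false.
  by apply/asboolP => /(_ B clB TB).
Qed.

End splice.

Lemma locally_compact_kR : kR_space R (Ck R X).
Proof.
move=> F; split=> [cF K _|kF]; first exact: continuous_subspaceT.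
apply/real_continuousP => f e e0; apply: contrapT => nF.
have e20 : 0 < e / 2 by lra.
(* One step of the construction: [phi (L, n)] is a function [h] that is
   [1/(n+1)]-close to [f] on [L] with [F h] far from [F f], and the next compact
   set, whose chain-closed supersets contain the points where [h] and [f]
   differ. *)
have /choice[phi phiP] : forall p : set X * nat, exists q : Ck R X * set X,
    compact p.1 -> [/\ compact q.2,
      forall x y, p.1 x -> chained x y -> q.2 y,
      forall x, p.1 x -> `|q.1 x - f x| < p.2.+1%:R^-1,
      e / 2 <= `|F q.1 - F f| &
      forall B, chain_closed B -> q.2 `<=` B -> forall x, ~ B x -> q.1 x = f x].
  move=> [L n]; have [cL|ncL] := pselect (compact L); last by exists (f, set0).
  have [g [gL gF]] : exists g, Ck_ball f L n.+1%:R^-1 g /\ e <= `|F g - F f|.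
    apply: contrapT => ng; apply: nF; apply/nbhs_CkP.
    exists L, n.+1%:R^-1; split => //.
    move=> g gL /=; rewrite ltNge; apply/negP => eg; apply: ng.
    by exists g.
  have [T [h [hF hfg hT]]] := splice_approx f g kF e20.
  have cT : compact [set` T] by apply: finite_compact; exact: finite_seq.
  have [D cD DP] := compact_chained (compactU cL cT).
  exists (h, D) => _; split => //=.
  - by move=> x y Lx; apply: DP; left.
  - move=> x Lx; case: (hfg x) => ->; first exact: gL.
    by rewrite subrr normr0 natinv_gt0.
  - by have := ler_distD (F h) (F g) (F f); rewrite (distrC (F g) (F h)); lra.
  - move=> B clB DB; apply: hT => // t tT; apply: DB.
    by apply: (DP t) (chained_refl t); right.
pose L := fix L n := if n is m.+1 then (phi (L m, m)).2 else set0.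
pose h n := (phi (L n, n)).1.
have cL n : compact (L n).
  by elim: n => [|n IHn]; [exact: compact0|case: (phiP (L n, n) IHn)].
have LS n x y : L n x -> chained x y -> L n.+1 y.
  by case: (phiP (L n, n) (cL n)) => _ + _ _ _; apply.
have Lmono m n : (m <= n)%N -> L m `<=` L n.
  elim: n => [|n IHn]; first by rewrite leqn0 => /eqP ->.
  rewrite leq_eqVlt => /orP[/eqP ->//|]; rewrite ltnS => /IHn mn x /mn Lx.
  exact: LS Lx (chained_refl x).
(* [h n = f] outside of the clopen set [U], and every point of [U] has a
   neighborhood contained in some [L m]. *)
pose U := \bigcup_n L n.
have clU : chain_closed U.
  by move=> x y [n _ Lx] xy; exists n.+1 => //; exact: LS xy.
have hf K r : compact K -> 0 < r -> \forall n \near \oo, Ck_ball f K r (h n).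
  move=> cK r0; have /compact_near_coveringP := cK.
  move=> /(_ nat \oo (fun n x => `|h n x - f x| < r)); apply => x Kx.
  have [[m _ Lmx]|nUx] := pselect (U x).
    have [N NP] := natinv_lt r0.
    exists ([set y | chained x y], [set n | (maxn m.+1 N <= n)%N]).
      by split; [exact: nbhs_chained|exists (maxn m.+1 N)].
    case=> y n /= [xy]; rewrite geq_max => /andP[mn /NP]; apply: lt_trans.
    case: (phiP (L n, n) (cL n)) => _ _ + _ _; apply => /=.
    by apply: Lmono mn _ _; exact: LS xy.
  exists ([set y | chained x y], setT).
    by split; [exact: nbhs_chained|exact: filterT].
  case=> y n /= [xy _]; rewrite [h n y](_ : _ = f y) ?subrr ?normr0//.
  case: (phiP (L n, n) (cL n)) => _ _ _ _ /(_ U clU); apply.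
    by move=> z Lz; exists n.+1.
  by move=> Uy; apply: nUx; exact: clU (chained_sym xy).
have cC : compact (f |` range h).
  apply: compact_cofinite_range => V /nbhs_CkP[K [r [cK r0 rV]]].
  have [N _ NP] := hf K r cK r0.
  apply: (sub_finite_set _ (finite_II N)) => n /= nV.
  by rewrite ltnNge; apply/negP => /NP /rV.
have /real_within_continuousP/(_ f _ (or_introl erefl) e20) := kF _ cC.
move=> /nbhs_CkP[K [r [cK r0 rV]]].
have [N _ /(_ N (leqnn N)) hN] := hf K r cK r0.
have := rV _ hN; rewrite /= => /(_ (or_intror (ex_intro2 _ _ N Logic.I erefl))).
by case: (phiP (L N, N) (cL N)) => _ _ _ + _; rewrite leNgt => /negP.
Qed.

End metric.

Theorem theorem1p4 (R : realType) (X : topologicalType)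
    (metrizableX : metrizable R X) :
  [<-> ascoli_space R (Ck R X);
       kR_space R (Ck R X);
       locally_compact [set: X]].
Proof.
case: metrizableX => d [d_eq0 dC dD nbhs_d].
have lc_kR : locally_compact [set: X] -> kR_space R (Ck R X).
  exact: (@locally_compact_kR R X d).
have asc_lc : ascoli_space R (Ck R X) -> locally_compact [set: X].
  exact: (@ascoli_locally_compact R X d).
have kR_asc := kR_ascoli (Ck_tychonoff R X).
by tfae => [/asc_lc/lc_kR|/kR_asc/asc_lc|/lc_kR/kR_asc].
Qed.
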